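(* Let $X$ be a metric space, let $Y$ be a linear metric space whose metric is shift invariant, and let $F:X\rightrightarrows Y$ be a set-valued mapping. If $F$ is strongly metrically subregular at $(\bar x,\bar y)\in\mathrm{graph}\,F$, then for any mapping $g:X\to Y$ such that $$\mathrm{subreg}\,F(\bar x,\bar y)\cdot\mathrm{clm}\,g(\bar x)<1,$$ the set-valued mapping $F+g$ is strongly metrically subregular at $(\bar x,\bar y+g(\bar x))$, and $$\mathrm{subreg}\,(F+g)(\bar x,\bar y+g(\bar x))\le\frac{\mathrm{subreg}\,F(\bar x,\bar y)}{1-\mathrm{subreg}\,F(\bar x,\bar y)\cdot\mathrm{clm}\,g(\bar x)}.$$
   Context: In a metric space, $B(x,r)$ denotes the closed ball with center $x$ and radius $r$, and $\mathrm{dist}(x,S)=\inf_{s\in S}d(x,s)$ is the distance from $x$ to $S$, with $\mathrm{dist}(x,\varnothing)=+\infty$. For a set-valued mapping $F:X\rightrightarrows Y$, $\mathrm{graph}\,F=\{(x,y): y\in F(x)\}$ and $F^{-1}(y)=\{x\in X: y\in F(x)\}$. The sum is $(F+g)(x)=\{y+g(x): y\in F(x)\}$. A metric $d$ on a linear space $Y$ is shift invariant if $d(u+w,v+w)=d(u,v)$ for all $u,v,w\in Y$. A set-valued mapping $F:X\rightrightarrows Y$ between metric spaces is metrically subregular at $(\bar x,\bar y)\in\mathrm{graph}\,F$ if there exist $\kappa\ge 0$ and $r>0$ such that $$\mathrm{dist}(x,F^{-1}(\bar y))\le\kappa\,\mathrm{dist}(\bar y,F(x)),\quad\forall x\in B(\bar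 x,r).$$ The modulus of subregularity $\mathrm{subreg}\,F(\bar x,\bar y)$ is the infimum of all $\kappa\ge 0$ for which there exists $r>0$ such that this inequality holds. $F$ is strongly metrically subregular at $(\bar x,\bar y)$ if it is metrically subregular at $(\bar x,\bar y)$ and, in addition, $\bar x$ is an isolated point of $F^{-1}(\bar y)$; equivalently, if there exist $\kappa\ge0$ and $r>0$ such that $d(x,\bar x)\le\kappa\,\mathrm{dist}(\bar y,F(x))$ for all $x\in B(\bar x,r)$. A set-valued mapping $G:X\rightrightarrows Y$ between metric spaces is calm at $(\bar x,\bar y)\in\mathrm{graph}\,G$ if there exist $\kappa\ge0$ and $r>0$ such that $$\sup_{y\in G(x)\cap B(\bar y,r)}\mathrm{dist}(y,G(\bar x))\le\kappa\,d(x,\bar x),\quad\forall x\in B(\bar x,r).$$ The calmness modulus $\mathrm{clm}\,G(\bar x,\bar y)$ is the infimum of all $\kappa\ge0$ for which there exists $r>0$ such that this inequality holds. For a single-valued mapping $g$, regarded as the set-valued mapping $x\mapsto\{g(x)\}$, the calmness modulus at $(\bar x,g(\bar x))$ is written $\mathrm{clm}\,g(\bar x)$.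
   Formalization: The formal theorem also assumes that g is continuous at x̄ and that clm g(x̄) is finite; with clm g taken from the set-valued definition, the claim fails without continuity (F(x)={x,−1}, g(0)=0, g(x)=1 for x≠0, at (0,0)), and, if 0·∞=0, without finiteness. *)

(* Defs.v *)
From HB Require Import structures.
From mathcomp Require Import all_boot all_order all_algebra.
From mathcomp Require Import all_classical all_reals.
From mathcomp Require Import topology ereal.

Set Implicit Arguments.
Unset Strict Implicit.
Unset Printing Implicit Defensive.

Import Order.TTheory GRing.Theory Num.Theory.

Local Open Scope classical_set_scope.
Local Open Scope ring_scope.

(* No compatibility between the metric and the linear operations is built in:
   shift invariance is a separate assumption (it makes the addition continuous),
   and continuity of the scaling is not assumed. *)
#[short(type="linearMetricType")]
HB.structure Definition LinearMetric (R : realType) :=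
  {V of Metric R V & GRing.Lmodule R V}.

Definition shift_invariant (R : realType) (Y : linearMetricType R) : Prop :=
  forall u v w : Y, mdist (u + w) (v + w) = mdist u v.

(* Not the library's [closed_ball], which is the closure of the open ball. *)
Definition cball (R : realType) (X : metricType R) (x : X) (r : R) : set X :=
  [set z | mdist z x <= r].

Definition dist (R : realType) (X : metricType R) (x : X) (S : set X) : \bar R :=
  ereal_inf [set (mdist x s)%:E | s in S].

(* A set-valued mapping from X to Y is a function X -> set Y; its values may be
   empty. *)
Definition svgraph (X Y : Type) (F : X -> set Y) : set (X * Y) :=
  [set p | F p.1 p.2].

Definition svinv (X Y : Type) (F : X -> set Y) (y : Y) : set X :=
  [set x | F x y].

Definition svadd (X : Type) (Y : nmodType) (F : X -> set Y) (g : X -> Y) :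
  X -> set Y := fun x => [set y + g x | y in F x].

Definition single_valued (X Y : Type) (g : X -> Y) : X -> set Y :=
  fun x => [set g x].

(* In the product [kappa * dist], 0 * +oo = 0. This affects neither the notions
   of subregularity nor the moduli below: under either convention for 0 * +oo,
   if kappa = 0 is a valid constant then so is every kappa > 0. *)
Definition subreg_on (R : realType) (X Y : metricType R) (F : X -> set Y)
    (xbar : X) (ybar : Y) (kappa r : R) : Prop :=
  forall x, cball xbar r x ->
    (dist x (svinv F ybar) <= kappa%:E * dist ybar (F x))%E.

Definition metrically_subregular (R : realType) (X Y : metricType R)
    (F : X -> set Y) (xbar : X) (ybar : Y) : Prop :=
  exists kappa r : R, [/\ 0 <= kappa, 0 < r & subreg_on F xbar ybar kappa r].

Definition subreg (R : realType) (X Y : metricType R) (F : X -> set Y)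
    (xbar : X) (ybar : Y) : \bar R :=
  ereal_inf [set kappa%:E | kappa in
    [set kappa : R | 0 <= kappa /\
                     exists2 r : R, 0 < r & subreg_on F xbar ybar kappa r]].

Definition strongly_metrically_subregular (R : realType) (X Y : metricType R)
    (F : X -> set Y) (xbar : X) (ybar : Y) : Prop :=
  metrically_subregular F xbar ybar /\ isolated (svinv F ybar) xbar.

(* The supremum of the empty set is -oo here: the points x with no value of G in
   the ball around ybar impose no condition. *)
Definition calm_on (R : realType) (X Y : metricType R) (G : X -> set Y)
    (xbar : X) (ybar : Y) (kappa r : R) : Prop :=
  forall x, cball xbar r x ->
    (ereal_sup [set dist y (G xbar) | y in G x `&` cball ybar r]
       <= (kappa * mdist x xbar)%:E)%E.

Definition clm (R : realType) (X Y : metricType R) (G : X -> set Y)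
    (xbar : X) (ybar : Y) : \bar R :=
  ereal_inf [set kappa%:E | kappa in
    [set kappa : R | 0 <= kappa /\
                     exists2 r : R, 0 < r & calm_on G xbar ybar kappa r]].

(* Because the values of G are cut down to a ball around ybar, a jump of g at
   xbar is invisible to this modulus; it is the usual limsup of
   d(g x, g xbar) / d(x, xbar) only when g is continuous at xbar. *)
Definition clm1 (R : realType) (X Y : metricType R) (g : X -> Y) (xbar : X) :
  \bar R := clm (single_valued g) xbar (g xbar).

(* Main.v *)
Require Import Defs.
From mathcomp Require Import all_boot all_order all_algebra.
From mathcomp Require Import all_classical all_reals.
From mathcomp Require Import topology ereal.
From mathcomp Require Import lra.

(** Strong subregularity of [F] at [(xbar, ybar)] is a pointwise inequality
    on the graph, without any inverse image: for some [kappa > 0],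
    [d(x, xbar) <= kappa * d(ybar, y)] for all [x] near [xbar] and all
    [y] in [F x].  The modulus of subregularity is then the infimum of these
    [kappa] ([subreg_lt_graph_bound], [graph_bound_subreg_on]).  Likewise, as
    [g] is continuous at [xbar], its calmness modulus is the infimum of the
    [lambda] such that [d(g x, g xbar) <= lambda * d(x, xbar)] near [xbar]
    ([clm1_lt_bound]).

    In these terms the perturbation is one triangle inequality: by shift
    invariance,
    [d(ybar, y) <= d(ybar + g xbar, y + g x) + d(g x, g xbar)], so that
    [d(x, xbar) <= kappa * (d(ybar + g xbar, y + g x) + lambda * d(x, xbar))],
    and solving for [d(x, xbar)] gives the graph inequality for [F + g] with
    constant [kappa / (1 - kappa * lambda)] ([graph_bound_svadd]).  It remains
    to let [kappa] and [lambda] decrease to the two moduli.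

    The condition [kappa / (1 - kappa * lambda) <= t] appears below in the
    division-free form [kappa * (1 + t * lambda) <= t], which for positive
    [kappa] and [t] also contains [kappa * lambda < 1]. *)

Set Implicit Arguments.
Unset Strict Implicit.
Unset Printing Implicit Defensive.

Import Order.TTheory GRing.Theory Num.Theory metricType_numDomainType.

Local Open Scope classical_set_scope.
Local Open Scope ring_scope.

Definition graph_bound (R : realType) (X Y : metricType R) (F : X -> set Y)
    (xbar : X) (ybar : Y) (kappa r : R) : Prop :=
  forall x y, mdist x xbar <= r -> F x y ->
    mdist x xbar <= kappa * mdist ybar y.

Lemma dist_le (R : realType) (X : metricType R) (x s : X) (S : set X) :
  S s -> (dist x S <= (mdist x s)%:E)%E.
Proof. by move=> Ss; apply: ereal_inf_lbound; exists s. Qed.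

Lemma subreg_le (R : realType) (X Y : metricType R) (F : X -> set Y)
    (xbar : X) (ybar : Y) (kappa r : R) :
  0 <= kappa -> 0 < r -> subreg_on F xbar ybar kappa r ->
  (subreg F xbar ybar <= kappa%:E)%E.
Proof.
move=> k0 r0 Fk; apply: ereal_inf_lbound; exists kappa => //.
by split=> //; exists r.
Qed.

Lemma subreg_ge0 (R : realType) (X Y : metricType R) (F : X -> set Y)
    (xbar : X) (ybar : Y) : (0 <= subreg F xbar ybar)%E.
Proof. by apply: le_ereal_inf_tmp => _ [k [k0 _] <-]; rewrite lee_fin. Qed.

Lemma clm_ge0 (R : realType) (X Y : metricType R) (G : X -> set Y)
    (xbar : X) (ybar : Y) : (0 <= clm G xbar ybar)%E.
Proof. by apply: le_ereal_inf_tmp => _ [k [k0 _] <-]; rewrite lee_fin. Qed.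

(** The other points of [S] are at distance at least [3 * r] from [xbar] for
    some [r], hence at distance at least [2 * r] from [x] once [x] is within
    [r] of [xbar]: the nearest point of [S] is [xbar]. *)
Lemma isolated_dist_ge (R : realType) (X : metricType R) (S : set X) (xbar : X) :
  isolated S xbar ->
  exists2 r : R, 0 < r &
    forall x, mdist x xbar <= r -> ((mdist x xbar)%:E <= dist x S)%E.
Proof.
move=> [_ [V /nbhs_mdistP[e /= e0 eV] VS]].
exists (e / 3%:R); first by rewrite divr_gt0.
move=> x xr; apply: le_ereal_inf_tmp => _ [z Sz <-]; rewrite lee_fin.
have [ze|ez] := ltP (mdist xbar z) e.
  have : (V `&` S) z by split=> //; exact: eV.
  by rewrite VS => ->.
have := metric_triangle xbar x z; rewrite (metric_sym xbar x).
lra.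
Qed.

Lemma subreg_lt_graph_bound (R : realType) (X Y : metricType R)
    (F : X -> set Y) (xbar : X) (ybar : Y) (kappa : R) :
  isolated (svinv F ybar) xbar -> (subreg F xbar ybar < kappa%:E)%E ->
  exists2 r : R, 0 < r & graph_bound F xbar ybar kappa r.
Proof.
move=> /isolated_dist_ge[r1 r10 isoF].
move=> /ereal_inf_lt[_ [k [k0 [r2 r20 Fk]] <-]]; rewrite lte_fin => kk.
exists (Num.min r1 r2); first by rewrite lt_min r10.
move=> x y; rewrite le_min => /andP[xr1 xr2] Fxy.
rewrite -lee_fin (le_trans (isoF x xr1))// (le_trans (Fk x xr2))//.
rewrite (@le_trans _ _ (k%:E * (mdist ybar y)%:E)%E)//.
  by apply: lee_wpmul2l; [rewrite lee_fin | exact: dist_le].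
by rewrite -EFinM lee_fin ler_wpM2r ?mdist_ge0// ltW.
Qed.

(** Positivity of [kappa] serves the points where [F x] is empty: there the
    right-hand side has to be infinite, while [0 * +oo = 0]. *)
Lemma graph_bound_subreg_on (R : realType) (X Y : metricType R)
    (F : X -> set Y) (xbar : X) (ybar : Y) (kappa r : R) :
  F xbar ybar -> 0 < kappa -> graph_bound F xbar ybar kappa r ->
  subreg_on F xbar ybar kappa r.
Proof.
move=> Fbar k0 Fk x xr; apply: (le_trans (dist_le x (s := xbar) _)) => //.
rewrite /dist -ereal_inf_pZl//.
apply: le_ereal_inf_tmp => _ [_ [y Fxy <-] <-].
by rewrite -EFinM lee_fin; exact: Fk.
Qed.

Lemma graph_bound_isolated (R : realType) (X Y : metricType R)
    (F : X -> set Y) (xbar : X) (ybar : Y) (kappa r : R) :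
  F xbar ybar -> 0 < r -> graph_bound F xbar ybar kappa r ->
  isolated (svinv F ybar) xbar.
Proof.
move=> Fbar r0 Fk; split; first exact/mem_set.
exists [set x | mdist xbar x < r]; first by rewrite -nbhs_nbhs_mdist; exists r.
apply/seteqP; split=> [x [/= xr Fx]|_ ->]; last by rewrite /= mdistxx.
have := Fk x ybar; rewrite mdistxx mulr0 metric_sym => /(_ (ltW xr) Fx) xx.
by apply/esym/mdist_positivity/le_anti; rewrite xx mdist_ge0.
Qed.

(** Continuity is what makes the modulus see the increments of [g]: it puts
    [g x] into the ball around [g xbar] to which the modulus cuts the values
    down. *)
Lemma clm1_lt_bound (R : realType) (X Y : metricType R) (g : X -> Y)
    (xbar : X) (lambda : R) :
  {for xbar, continuous g} -> (clm1 g xbar < lambda%:E)%E ->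
  exists2 r : R, 0 < r & forall x, mdist x xbar <= r ->
    mdist (g x) (g xbar) <= lambda * mdist x xbar.
Proof.
move=> gC /ereal_inf_lt[_ [l [l0 [r1 r10 gl]] <-]]; rewrite lte_fin => ll.
have /nbhs_mdistP[r2 /= r20 gr2] :
    \forall x \near xbar, mdist (g xbar) (g x) <= r1.
  exact: cvgr_dist_le gC _ r10.
exists (Num.min r1 (r2 / 2%:R)); first by rewrite lt_min r10 divr_gt0.
move=> x; rewrite le_min => /andP[xr1 xr2].
have gx : cball (g xbar) r1 (g x).
  rewrite /cball/= metric_sym; apply: gr2 => /=.
  by rewrite metric_sym (le_lt_trans xr2)// gtr_pMr// invf_lt1 ?ltr1n.
have /= := gl x xr1.
rewrite /single_valued => /ereal_supP/(_ (dist (g x) [set g xbar])) H.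
have : (dist (g x) [set g xbar] <= (l * mdist x xbar)%:E)%E.
  by apply: H; exists (g x).
rewrite /dist image_set1 ereal_inf1 lee_fin => /le_trans; apply.
by rewrite ler_wpM2r ?mdist_ge0// ltW.
Qed.

Lemma graph_bound_svadd (R : realType) (X : metricType R)
    (Y : linearMetricType R) (F : X -> set Y) (g : X -> Y) (xbar : X) (ybar : Y)
    (kappa lambda t r : R) :
  shift_invariant Y -> 0 < kappa -> 0 < t ->
  kappa * (1 + t * lambda) <= t ->
  graph_bound F xbar ybar kappa r ->
  (forall x, mdist x xbar <= r ->
     mdist (g x) (g xbar) <= lambda * mdist x xbar) ->
  graph_bound (svadd F g) xbar (ybar + g xbar) t r.
Proof.
move=> Yshift k0 t0 kt Fk gl x _ xr [y Fxy <-].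
set d := mdist x xbar; set D := mdist (ybar + g xbar) (y + g x).
have yD : mdist ybar y <= D + lambda * d.
  rewrite -(Yshift ybar y (g xbar)).
  apply: (le_trans (metric_triangle _ (y + g x) _)); rewrite lerD2l.
  by rewrite ![y + _]addrC Yshift gl.
have dD : d <= kappa * (D + lambda * d).
  by apply: (le_trans (Fk x y xr Fxy)); rewrite ler_pM2l.
(* [t * dD] and [d * kt] add up to [kappa * d <= kappa * (t * D)]. *)
rewrite -(ler_pM2l k0).
have := ler_wpM2l (ltW t0) dD.
have := ler_wpM2r (mdist_ge0 x xbar) kt; rewrite -/d.
lra.
Qed.

(** The map [(kappa, lambda) |-> kappa * (1 + t * lambda)] is continuous;
    [e] is an explicit common increment within the available gap. *)
Lemma strict_perturb (R : realType) (s c t : R) :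
  0 <= s -> 0 <= c -> 0 < t -> s * (1 + t * c) < t ->
  exists kappa lambda : R,
    [/\ s < kappa, c < lambda & kappa * (1 + t * lambda) <= t].
Proof.
move=> s0 c0 t0 gap.
pose M := 1 + t * c + t * s + t.
have tc0 : 0 <= t * c by rewrite mulr_ge0// ltW.
have ts0 : 0 <= t * s by rewrite mulr_ge0// ltW.
have M0 : 0 < M by rewrite /M; lra.
pose e := Num.min 1 ((t - s * (1 + t * c)) / M).
have e0 : 0 < e by rewrite lt_min ltr01 divr_gt0// subr_gt0.
have e1 : e <= 1 by rewrite ge_min lexx.
have eM : e * M <= t - s * (1 + t * c).
  by rewrite -ler_pdivlMr// ge_min lexx orbT.
exists (s + e), (c + e); split; rewrite ?ltrDl//.
have tee : t * e * e <= t * e by rewrite ler_piMr// mulr_ge0// ltW.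
move: eM; rewrite /M; lra.
Qed.

Theorem theorem3 (R : realType) (X : metricType R) (Y : linearMetricType R)
    (Y_shift : shift_invariant Y)
    (F : X -> set Y) (xbar : X) (ybar : Y)
    (F_graph : svgraph F (xbar, ybar))
    (F_sms : strongly_metrically_subregular F xbar ybar)
    (g : X -> Y)
    (g_cont : {for xbar, continuous g})
    (g_clm : (clm1 g xbar < +oo)%E)
    (Fg_lt1 : (subreg F xbar ybar * clm1 g xbar < 1)%E) :
  strongly_metrically_subregular (svadd F g) xbar (ybar + g xbar) /\
  (subreg (svadd F g) xbar (ybar + g xbar)%R
     <= subreg F xbar ybar / (1 - subreg F xbar ybar * clm1 g xbar))%E.
Proof.
have [[k [r [k0 r0 Fk]]] Fiso] := F_sms.
have [s s0 sE] : exists2 s : R, 0 <= s & subreg F xbar ybar = s%:E.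
  have := subreg_ge0 F xbar ybar; have := subreg_le k0 r0 Fk.
  by case: (subreg F xbar ybar) => [s _ s0|//|//]; exists s.
have [c c0 cE] : exists2 c : R, 0 <= c & clm1 g xbar = c%:E.
  have := clm_ge0 (single_valued g) xbar (g xbar); rewrite -/(clm1 g xbar).
  by move: g_clm; case: (clm1 g xbar) => [c _ c0|//|//]; exists c.
have Fgbar : svadd F g xbar (ybar + g xbar) by exists ybar.
move: Fg_lt1; rewrite sE cE -EFinM lte_fin => sc1.
have sc0 : 0 < 1 - s * c by rewrite subr_gt0.
have q0 : 0 <= s / (1 - s * c) by rewrite divr_ge0// ltW.
have bound (e : R) : 0 < e -> exists2 r' : R, 0 < r' &
    graph_bound (svadd F g) xbar (ybar + g xbar) (s / (1 - s * c) + e) r'.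
  move=> e0; set t := _ + e.
  have t0 : 0 < t by rewrite /t; lra.
  have gap : s * (1 + t * c) < t.
    have : t * (1 - s * c) = s + e * (1 - s * c).
      by rewrite mulrDl divfK// gt_eqF.
    have := mulr_gt0 e0 sc0; lra.
  have [kappa [lambda [sk cl kt]]] := strict_perturb s0 c0 t0 gap.
  have [|r1 r10 Fk1] := @subreg_lt_graph_bound _ _ _ F xbar ybar kappa Fiso.
    by rewrite sE lte_fin.
  have [|r2 r20 gl2] := @clm1_lt_bound _ _ _ g xbar lambda g_cont.
    by rewrite cE lte_fin.
  exists (Num.min r1 r2); first by rewrite lt_min r10.
  apply: (@graph_bound_svadd _ _ _ _ _ _ _ kappa lambda) => //.
  - exact: le_lt_trans sk.
  - by move=> x y; rewrite le_min => /andP[xr1 _]; exact: Fk1.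
  - by move=> x; rewrite le_min => /andP[_ xr2]; exact: gl2.
split.
  have [r' r'0 Fgb] := bound 1 ltr01.
  split; last exact: graph_bound_isolated Fgb.
  exists (s / (1 - s * c) + 1), r'; split=> //; first by rewrite addr_ge0.
  by apply: graph_bound_subreg_on; rewrite // ltr_wpDl.
rewrite -EFinB inver gt_eqF// -EFinM.
apply/lee_addgt0Pr => e e0; have [r' r'0 Fgb] := bound e e0.
rewrite -EFinD; apply: subreg_le r'0 _; first by rewrite addr_ge0// ltW.
by apply: graph_bound_subreg_on; rewrite // ltr_wpDl.
Qed.
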